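(* Let $\mathfrak g=(\mathfrak g_0\oplus\mathfrak g_{-1},d,[\cdot,\cdot],l_3)$ be a Lie $2$-algebra. Let $\mathrm{Inn}^0(\mathfrak g)=e^{\mathrm{inn}^0(\mathfrak g)}$ and $\mathrm{Inn}^{-1}(\mathfrak g)=e^{\mathrm{inn}^{-1}(\mathfrak g)}$ be the connected Lie subgroups of $\mathrm{Aut}^0(\mathfrak g)$ and $\mathrm{Aut}^{-1}(\mathfrak g)$ with Lie algebras $\mathrm{inn}^0(\mathfrak g)$ and $\mathrm{inn}^{-1}(\mathfrak g)$, respectively. Then $\mathrm{Inn}(\mathfrak g)=(\mathrm{Inn}^{-1}(\mathfrak g)\xrightarrow{\partial}\mathrm{Inn}^0(\mathfrak g))$ is a normal sub-crossed module of $\mathrm{Aut}(\mathfrak g)=(\mathrm{Aut}^{-1}(\mathfrak g),\mathrm{Aut}^0(\mathfrak g),\partial,\triangleright)$.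
   Context: All vector spaces are real and finite-dimensional. A Lie $2$-algebra $\mathfrak g=(\mathfrak g_0\oplus\mathfrak g_{-1},d,[\cdot,\cdot],l_3)$ consists of vector spaces $\mathfrak g_0,\mathfrak g_{-1}$, a linear map $d:\mathfrak g_{-1}\to\mathfrak g_0$, a skew-symmetric bilinear bracket with $[x,y]\in\mathfrak g_0$, $[x,a]=-[a,x]\in\mathfrak g_{-1}$, $[a,b]=0$ for $x,y\in\mathfrak g_0$, $a,b\in\mathfrak g_{-1}$, and a skew-symmetric trilinear map $l_3:\wedge^3\mathfrak g_0\to\mathfrak g_{-1}$ such that for all $x,y,z,x_i\in\mathfrak g_0$, $a,b\in\mathfrak g_{-1}$: (a) $d[x,a]=[x,da]$, $[da,b]=[a,db]$; (b) $[[x,y],z]+[[y,z],x]+[[z,x],y]=-dl_3(x,y,z)$, $[[x,y],a]+[[y,a],x]+[[a,x],y]=-l_3(x,y,da)$; (c) $\sum_{i=1}^4(-1)^{i+1}[x_i,l_3(x_1,\dots,\hat x_i,\dots,x_4)]+\sum_{i<j}(-1)^{i+j}l_3([x_i,x_j],x_1,\dots,\hat x_i,\dots,\hat x_j,\dots,x_4)=0$. $\mathrm{Aut}^0(\mathfrak g)$ is the Lie group of triples $(A_0,A_1,A_2)$, $A_0\in GL(\mathfrak g_0)$, $A_1\in GL(\mathfrak g_{-1})$, $A_0d=dA_1$, $A_2:\wedge^2\mathfrak g_0\to\mathfrak g_{-1}$, with $A_0[x,y]-[A_0x,A_0y]=dA_2(x,y)$, $A_1[x,a]-[A_0x,A_1a]=A_2(x,da)$,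 $[A_0x,A_2(y,z)]+c.p.+l_3(A_0x,A_0y,A_0z)=A_2([x,y],z)+c.p.+A_1l_3(x,y,z)$ ($c.p.$: remaining cyclic permutations of $x,y,z$), under $(B\diamond A)_0=B_0A_0$, $(B\diamond A)_1=B_1A_1$, $(B\diamond A)_2=B_2\circ(A_0\times A_0)+B_1\circ A_2$. $\mathrm{Aut}^{-1}(\mathfrak g)$ is the Lie group of units of $\mathrm{Hom}(\mathfrak g_0,\mathfrak g_{-1})$ with product $\tau\star\tau'=\tau+\tau'+\tau\circ d\circ\tau'$. One has $\partial(\tau)=(I+d\circ\tau,I+\tau\circ d,l_\tau)$ with $l_\tau(x,y)=\tau[x,y]-[x,\tau y]-[\tau x,y]-[\tau x,d\tau y]$, and $A\triangleright\tau=A_1\circ\tau\circ A_0^{-1}$; this is a crossed module of Lie groups. The Lie algebra of $\mathrm{Aut}^0(\mathfrak g)$ is $\mathrm{Der}^0(\mathfrak g)$, the set of triples $(X_0,X_1,l_X)$ with $X_0\in\mathrm{End}(\mathfrak g_0)$, $X_1\in\mathrm{End}(\mathfrak g_{-1})$, $X_0d=dX_1$, $l_X:\wedge^2\mathfrak g_0\to\mathfrak g_{-1}$, $dl_X(x,y)=X_0[x,y]-[X_0x,y]-[x,X_0y]$, $l_X(x,da)=X_1[x,a]-[X_0x,a]-[x,X_1a]$, $X_1l_3(x,y,z)=\big(l_X(x,[y,z])+[x,l_X(y,z)]+l_3(X_0x,y,z)\big)+c.p.$, with bracket $\{(X,l_X),(Y,l_Y)\}=([X_0,Y_0],[X_1,Y_1],L_Xl_Y-L_Yl_X)$,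 $L_X\omega(x,y)=X_1\omega(x,y)-\omega(X_0x,y)-\omega(x,X_0y)$. The Lie algebra of $\mathrm{Aut}^{-1}(\mathfrak g)$ is $\mathrm{Der}^{-1}(\mathfrak g)=\mathrm{Hom}(\mathfrak g_0,\mathfrak g_{-1})$ with bracket $\Theta d\Theta'-\Theta'd\Theta$. Let $\bar d(\Theta)=(d\circ\Theta,\Theta\circ d,l_{\delta(\Theta)})$, $l_{\delta(\Theta)}(x,y)=\Theta[x,y]-[x,\Theta y]-[\Theta x,y]$, and for $x\in\mathfrak g_0$ let $\overline{\mathfrak{ad}}_0(x)=([x,\cdot]|_{\mathfrak g_0},[x,\cdot]|_{\mathfrak g_{-1}},l_3(x,\cdot,\cdot))\in\mathrm{Der}^0(\mathfrak g)$. Inner derivations: $\mathrm{inn}^{-1}(\mathfrak g)=\mathrm{Hom}(\mathfrak g_0,\mathfrak g_{-1})$ and $\mathrm{inn}^0(\mathfrak g)=\mathrm{Im}\,\overline{\mathfrak{ad}}_0+\mathrm{Im}\,\bar d$, a Lie subalgebra of $\mathrm{Der}^0(\mathfrak g)$. A sub-crossed module $(N_1,N_0)$ of a crossed module $(H_1,H_0,\partial,\triangleright)$ (subgroups $N_i\le H_i$ with $\partial(N_1)\subset N_0$ and $N_0\triangleright N_1\subset N_1$) is normal (in the sense of Norrie) if $N_0$ is normal in $H_0$, $g\triangleright n\in N_1$ for all $g\in H_0,n\in N_1$, and $(m\triangleright h)h^{-1}\in N_1$ for all $m\in N_0,h\in H_1$. *)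

(* Defs.v *)
From HB Require Import structures.
From mathcomp Require Import all_boot all_order all_algebra.
From mathcomp Require Import boolp classical_sets reals topology normedtype derive.
From mathcomp Require Import ring lra.
Import GRing.Theory Num.Theory.
Import numFieldNormedType.Exports.

Set Implicit Arguments.
Unset Strict Implicit.
Unset Printing Implicit Defensive.

Local Open Scope classical_set_scope.
Local Open Scope ring_scope.

Section Bilinear.
Variables (R : realType) (U V W : vectType R).

Lemma lfunD (f : 'Hom(U, V)) x y : f (x + y) = f x + f y.
Proof. exact: linearD. Qed.
Lemma lfunN (f : 'Hom(U, V)) x : f (- x) = - f x.
Proof. exact: linearN. Qed.
Lemma lfun0 (f : 'Hom(U, V)) : f 0 = 0.
Proof. exact: linear0. Qed.
Lemma lfunZ (f : 'Hom(U, V)) a x : f (a *: x) = a *: f x.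
Proof. exact: linearZ. Qed.

(* Only meaningful when f is bilinear, see bilinE. *)
Definition bilin (f : U -> V -> W) : 'Hom(U, 'Hom(V, W)) :=
  linfun (fun x => linfun (f x)).

Lemma linfunE (A B : vectType R) (f : A -> B) : linear f -> linfun f =1 f.
Proof.
move=> lf x.
pose m := GRing.isLinear.Build R A B *:%R f lf.
pose ff : {linear A -> B} := HB.pack f m.
by rewrite -[LHS]/(linfun ff x) lfunE.
Qed.

Lemma bilinE (f : U -> V -> W) :
  (forall x, linear (f x)) -> (forall y, linear (f^~ y)) ->
  forall x y, bilin f x y = f x y.
Proof.
move=> lf1 lf2 x y; rewrite /bilin linfunE; first exact: linfunE.
move=> a u v; apply/lfunP => z.
by rewrite add_lfunE scale_lfunE !(linfunE (lf1 _)) lf2.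
Qed.

Lemma functionalP (u v : V) :
  (forall phi : V -> R, {morph phi : x y / x + y} -> {morph phi : x / - x} ->
    (forall a x, phi (a *: x) = a * phi x) -> phi 0 = 0 -> phi u = phi v) ->
  u = v.
Proof.
move=> h; apply/eqP; rewrite -subr_eq0.
rewrite (coord_vbasis (memvf (u - v))); apply/eqP.
apply: big1 => i _.
have := h (coord (vbasis fullv) i) (linearD _) (linearN _) (linearZ_LR _) (linear0 _).
by rewrite linearB /= => ->; rewrite subrr scale0r.
Qed.

End Bilinear.

Definition lfE := (lfunD, lfunN, lfunZ, lfun0, zero_lfunE,
  add_lfunE, opp_lfunE, scale_lfunE, comp_lfunE, id_lfunE).

Ltac lfun_ring :=
  let phi := fresh "phi" in let phiD := fresh "phiD" in
  let phiN := fresh "phiN" in let phiZ := fresh "phiZ" in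
  let phi0 := fresh "phi0" in
  apply: functionalP; intros phi phiD phiN phiZ phi0;
  rewrite ?lfE ?(phiD, phiN, phiZ, phi0); ring.
Ltac lfun_bilin :=
  rewrite bilinE; [|move=> ? ? ? ?; rewrite ?lfE /=; lfun_ring..].

(* Proves that an equation between vectors is a linear combination of the
   equations in the context. *)
Ltac lfun_lin :=
  let phi := fresh "phi" in let phiD := fresh "phiD" in
  let phiN := fresh "phiN" in let phiZ := fresh "phiZ" in
  let phi0 := fresh "phi0" in
  apply: functionalP; intros phi phiD phiN phiZ phi0;
  repeat match goal with
  | H : _ = _ |- _ => apply (congr1 phi) in H; rewrite ?lfE ?(phiD, phiN, phi0) in H
  end;
  rewrite ?lfE ?(phiD, phiN, phi0); lra.

(* The bracket [x, a] = - [a, x] of x in g0 with a in g_{-1} is br1 x a; the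
   space g_{-1} is called g1 throughout. For instance [[y, a], x] is
   - br1 x (br1 y a) and [[a, x], y] is - br1 y (- br1 x a). *)
Record lie2Algebra (R : realType) (g0 g1 : vectType R) := Lie2Algebra {
  ldiff : 'Hom(g1, g0);
  br0 : 'Hom(g0, 'Hom(g0, g0));
  br1 : 'Hom(g0, 'Hom(g1, g1));
  l3 : 'Hom(g0, 'Hom(g0, 'Hom(g0, g1)));
  br0_skew : forall x y, br0 x y = - br0 y x;
  l3_skew12 : forall x y z, l3 x y z = - l3 y x z;
  l3_skew23 : forall x y z, l3 x y z = - l3 x z y;
  ldiff_br1 : forall x a, ldiff (br1 x a) = br0 x (ldiff a);
  br1_ldiff : forall a b, br1 (ldiff a) b = - br1 (ldiff b) a;
  jacobi0 : forall x y z,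
    br0 (br0 x y) z + br0 (br0 y z) x + br0 (br0 z x) y = - ldiff (l3 x y z);
  jacobi1 : forall x y a,
    br1 (br0 x y) a + (- br1 x (br1 y a)) + (- br1 y (- br1 x a))
    = - l3 x y (ldiff a);
  l3_coherence : forall x1 x2 x3 x4,
    br1 x1 (l3 x2 x3 x4) - br1 x2 (l3 x1 x3 x4)
    + br1 x3 (l3 x1 x2 x4) - br1 x4 (l3 x1 x2 x3)
    + (- l3 (br0 x1 x2) x3 x4 + l3 (br0 x1 x3) x2 x4 - l3 (br0 x1 x4) x2 x3
       - l3 (br0 x2 x3) x1 x4 + l3 (br0 x2 x4) x1 x3 - l3 (br0 x3 x4) x1 x2)
    = 0
}.

Section InvLfun.
Variables (R : realType) (V : vectType R) (f : 'End(V)).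
Hypothesis fbij : bijective f.

Let kerf : lker f == 0%VS. Proof. exact/lker0P/bij_inj. Qed.

Lemma bij_lfunK : cancel f f^-1%VF. Proof. exact: lker0_lfunK. Qed.
Lemma bij_lfunVK : cancel f^-1%VF f. Proof. exact: lker0_lfunVK. Qed.
Lemma bij_lfunV : bijective f^-1%VF.
Proof. by exists f; [exact: bij_lfunVK|exact: bij_lfunK]. Qed.

End InvLfun.

Section Triple.
Variables (R : realType) (g0 g1 : vectType R).

(* The vector space containing both Aut^0 and Der^0: a linear map of g0, one
   of g_{-1}, and a bilinear map g0 x g0 -> g_{-1}. *)
Definition triple : vectType R :=
  ('End(g0) * 'End(g1) * 'Hom(g0, 'Hom(g0, g1)))%type.

Definition c0 (A : triple) : 'End(g0) := A.1.1.
Definition c1 (A : triple) : 'End(g1) := A.1.2.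
Definition c2 (A : triple) : 'Hom(g0, 'Hom(g0, g1)) := A.2.

Lemma tripleP (A B : triple) : c0 A =1 c0 B -> c1 A =1 c1 B ->
  (forall x y, c2 A x y = c2 B x y) -> A = B.
Proof.
case: A B => [[A0 A1] A2] [[B0 B1] B2] /lfunP e0 /lfunP e1 e2.
rewrite /c0 /c1 /c2 /= in e0 e1 e2; rewrite e0 e1; congr pair.
by apply/lfunP => x; apply/lfunP => y.
Qed.

Definition triple1 : triple := (\1%VF, \1%VF, 0).
Definition triple_mul (B A : triple) : triple :=
  ((c0 B \o c0 A)%VF, (c1 B \o c1 A)%VF,
   bilin (fun x y => c2 B (c0 A x) (c0 A y) + c1 B (c2 A x y))).
Definition triple_inv (A : triple) : triple :=
  ((c0 A)^-1%VF, (c1 A)^-1%VF,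
   bilin (fun x y => - (c1 A)^-1%VF (c2 A ((c0 A)^-1%VF x) ((c0 A)^-1%VF y)))).

Lemma c0M B A x : c0 (triple_mul B A) x = c0 B (c0 A x).
Proof. by rewrite comp_lfunE. Qed.
Lemma c1M B A a : c1 (triple_mul B A) a = c1 B (c1 A a).
Proof. by rewrite comp_lfunE. Qed.
Lemma c2M B A x y :
  c2 (triple_mul B A) x y = c2 B (c0 A x) (c0 A y) + c1 B (c2 A x y).
Proof. by rewrite /c2 /triple_mul /= -!/(c2 _); lfun_bilin. Qed.
Lemma c0V A : c0 (triple_inv A) = (c0 A)^-1%VF. Proof. by []. Qed.
Lemma c1V A : c1 (triple_inv A) = (c1 A)^-1%VF. Proof. by []. Qed.
Lemma c2V A x y : c2 (triple_inv A) x y =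
  - (c1 A)^-1%VF (c2 A ((c0 A)^-1%VF x) ((c0 A)^-1%VF y)).
Proof. by rewrite /c2 /triple_inv /= -!/(c2 _); lfun_bilin. Qed.
Lemma c2_1 x y : c2 triple1 x y = 0.
Proof. by rewrite /c2 /= !zero_lfunE. Qed.

End Triple.

Section Aut.
Variables (R : realType) (g0 g1 : vectType R) (g : lie2Algebra g0 g1).
Local Notation d := (ldiff g).
Local Notation br0 := (br0 g).
Local Notation br1 := (br1 g).
Local Notation l3 := (l3 g).
Local Notation triple := (triple g0 g1).
Implicit Types (A B : triple) (t : 'Hom(g0, g1)) (x y z : g0) (a b : g1).

Record is_aut0 (A : triple) : Prop := IsAut0 {
  aut0_bij0 : bijective (c0 A);
  aut0_bij1 : bijective (c1 A);
  aut0_d : forall a, c0 A (d a) = d (c1 A a);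
  aut0_skew : forall x y, c2 A x y = - c2 A y x;
  aut0_br0 : forall x y,
    c0 A (br0 x y) - br0 (c0 A x) (c0 A y) = d (c2 A x y);
  aut0_br1 : forall x a,
    c1 A (br1 x a) - br1 (c0 A x) (c1 A a) = c2 A x (d a);
  aut0_l3 : forall x y z,
    br1 (c0 A x) (c2 A y z) + br1 (c0 A y) (c2 A z x) + br1 (c0 A z) (c2 A x y)
    + l3 (c0 A x) (c0 A y) (c0 A z)
    = c2 A (br0 x y) z + c2 A (br0 y z) x + c2 A (br0 z x) y
      + c1 A (l3 x y z)
}.

Lemma is_aut0_1 : is_aut0 (triple1 g0 g1).
Proof.
split; rewrite /c0 /c1 /=.
- by exists id => x; rewrite id_lfunE.
- by exists id => x; rewrite id_lfunE.
- by move=> a; rewrite !id_lfunE.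
- by move=> x y; rewrite !c2_1 oppr0.
- by move=> x y; rewrite !c2_1 !id_lfunE subrr linear0.
- by move=> x y; rewrite !c2_1 !id_lfunE subrr.
- by move=> x y z; rewrite !c2_1 !id_lfunE !linear0 !add0r.
Qed.

Lemma is_aut0_mul B A : is_aut0 B -> is_aut0 A -> is_aut0 (triple_mul B A).
Proof.
move=> hB hA; split.
- apply: (@eq_bij _ _ (c0 B \o c0 A)%FUN); last by move=> x; rewrite c0M.
  by apply: bij_comp; [exact: aut0_bij0 hB|exact: aut0_bij0 hA].
- apply: (@eq_bij _ _ (c1 B \o c1 A)%FUN); last by move=> x; rewrite c1M.
  by apply: bij_comp; [exact: aut0_bij1 hB|exact: aut0_bij1 hA].
- by move=> a; rewrite c0M c1M (aut0_d hA) (aut0_d hB).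
- by move=> x y; rewrite !c2M (aut0_skew hB) (aut0_skew hA) !lfE opprD.
- move=> x y; rewrite !c0M !c2M lfunD -(aut0_br0 hB) -(aut0_d hB).
  by rewrite -(aut0_br0 hA); lfun_ring.
- move=> x a; rewrite !c0M !c2M !c1M -(aut0_br1 hA) (aut0_d hA).
  by rewrite -(aut0_br1 hB); lfun_ring.
- move=> x y z; rewrite !c0M !c2M !c1M.
  have h1 := congr1 (c1 B) (aut0_l3 hA x y z).
  have h2 := aut0_l3 hB (c0 A x) (c0 A y) (c0 A z).
  have ha u v w : c2 B (c0 A u) (c0 A (br0 v w)) =
     c2 B (c0 A u) (br0 (c0 A v) (c0 A w)) +
     (c1 B (br1 (c0 A u) (c2 A v w)) - br1 (c0 B (c0 A u)) (c1 B (c2 A v w))).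
    by rewrite (aut0_br1 hB) -(aut0_br0 hA); lfun_ring.
  have sk u v := aut0_skew hB (c0 A (br0 u v)).
  rewrite !sk !ha.
  rewrite !(aut0_skew hB (br0 _ _)) in h2.
  by lfun_lin.
Qed.

Lemma is_aut0_inv A : is_aut0 A -> is_aut0 (triple_inv A).
Proof.
move=> hA; have b0 := aut0_bij0 hA; have b1 := aut0_bij1 hA.
have K0 := bij_lfunK b0; have V0 := bij_lfunVK b0.
have K1 := bij_lfunK b1; have V1 := bij_lfunVK b1.
have d' a : (c0 A)^-1%VF (d a) = d ((c1 A)^-1%VF a).
  by apply: (bij_inj b0); rewrite V0 (aut0_d hA) V1.
split; rewrite ?c0V ?c1V.
- exact: bij_lfunV.
- exact: bij_lfunV.
- exact: d'.
- by move=> x y; rewrite !c2V (aut0_skew hA) !lfE.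
- move=> x y; rewrite c2V -[x in LHS]V0 -[y in LHS]V0 !K0.
  by rewrite lfunN -d' -(aut0_br0 hA) lfunD lfunN K0; lfun_ring.
- move=> x a; rewrite c2V d' -(aut0_br1 hA).
  by rewrite V0 V1 lfunD K1 lfunN; lfun_ring.
- move=> x y z; rewrite !c2V.
  have surj r : exists q, r = c0 A q by exists ((c0 A)^-1%VF r); rewrite V0.
  have [u ->] := surj x; have [v ->] := surj y; have [w ->] := surj z.
  rewrite !K0.
  have e p q r : c1 A (br1 p ((c1 A)^-1%VF (c2 A q r))) =
     br1 (c0 A p) (c2 A q r) + c2 A p (br0 q r) -
     c2 A p ((c0 A)^-1%VF (br0 (c0 A q) (c0 A r))).
    have := aut0_br1 hA p ((c1 A)^-1%VF (c2 A q r)).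
    rewrite V1 -d' -(aut0_br0 hA) !lfE K0 => h.
    by lfun_lin.
  apply: (bij_inj b1); rewrite !lfE !V1 !e.
  have h := aut0_l3 hA u v w.
  rewrite !(aut0_skew hA (br0 _ _)) in h.
  rewrite !(aut0_skew hA ((c0 A)^-1%VF _)).
  by lfun_lin.
Qed.

Lemma triple_mulA : associative (@triple_mul R g0 g1).
Proof.
move=> C B A; apply: tripleP => [x|x|x y]; rewrite ?(c0M, c1M) //.
by rewrite !c2M !(c0M, c1M) lfunD addrA.
Qed.

Lemma triple_mul1 A : triple_mul (triple1 g0 g1) A = A.
Proof.
apply: tripleP => [x|x|x y]; rewrite ?(c0M, c1M, c2M, c2_1) ?add0r //;
by rewrite /c0 /c1 /= id_lfunE.
Qed.

Lemma triple_mulr1 A : triple_mul A (triple1 g0 g1) = A.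
Proof.
apply: tripleP => [x|x|x y]; rewrite ?(c0M, c1M, c2M, c2_1);
by rewrite /triple1 /c0 /c1 /= !id_lfunE ?linear0 ?addr0.
Qed.

Lemma triple_mulV A : is_aut0 A -> triple_mul (triple_inv A) A = triple1 g0 g1.
Proof.
move=> hA; have b0 := aut0_bij0 hA; have b1 := aut0_bij1 hA.
apply: tripleP => [x|x|x y];
  rewrite ?(c0M, c1M, c2M, c2V, c0V, c1V, c2_1) ?(bij_lfunK b0, bij_lfunK b1).
- by rewrite /c0 /= id_lfunE.
- by rewrite /c1 /= id_lfunE.
- by rewrite addNr.
Qed.

Lemma triple_mulrV A : is_aut0 A -> triple_mul A (triple_inv A) = triple1 g0 g1.
Proof.
move=> hA; have b0 := aut0_bij0 hA; have b1 := aut0_bij1 hA.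
apply: tripleP => [x|x|x y];
  rewrite ?(c0M, c1M, c2M, c2V, c0V, c1V, c2_1) ?(bij_lfunVK b0, bij_lfunVK b1).
- by rewrite /c0 /= id_lfunE.
- by rewrite /c1 /= id_lfunE.
- by rewrite lfunN (bij_lfunVK b1) subrr.
Qed.

Record aut0 := Aut0 { aut0_val : triple; _ : `[< is_aut0 aut0_val >] }.

HB.instance Definition _ := [isSub for aut0_val].
HB.instance Definition _ := [Choice of aut0 by <:].

Lemma aut0P (A : aut0) : is_aut0 (aut0_val A).
Proof. by case: A => A /= /asboolP. Qed.

Definition mk_aut0 A (hA : is_aut0 A) : aut0 := Aut0 (asboolT hA).

Definition aut0_one : aut0 := mk_aut0 is_aut0_1.
Definition aut0_mul (B A : aut0) : aut0 :=
  mk_aut0 (is_aut0_mul (aut0P B) (aut0P A)).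
Definition aut0_inv (A : aut0) : aut0 := mk_aut0 (is_aut0_inv (aut0P A)).

Fact aut0_mulA : associative aut0_mul.
Proof. by move=> A B C; apply/val_inj/triple_mulA. Qed.
Fact aut0_mul1 : left_id aut0_one aut0_mul.
Proof. by move=> A; apply/val_inj/triple_mul1. Qed.
Fact aut0_mulr1 : right_id aut0_one aut0_mul.
Proof. by move=> A; apply/val_inj/triple_mulr1. Qed.
Fact aut0_mulV : left_inverse aut0_one aut0_inv aut0_mul.
Proof. by move=> A; apply/val_inj/triple_mulV/aut0P. Qed.
Fact aut0_mulrV : right_inverse aut0_one aut0_inv aut0_mul.
Proof. by move=> A; apply/val_inj/triple_mulrV/aut0P. Qed.

HB.instance Definition _ :=
  isGroup.Build aut0 aut0_mulA aut0_mul1 aut0_mulr1 aut0_mulV aut0_mulrV.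

Definition star t t' : 'Hom(g0, g1) := t + t' + (t \o d \o t')%VF.

Lemma starE t t' x : star t t' x = t x + t' x + t (d (t' x)).
Proof. by rewrite !lfE. Qed.

Lemma starA : associative star.
Proof.
by move=> t u v; apply/lfunP => x; rewrite !(starE, lfE); lfun_ring.
Qed.
Lemma star0 : left_id 0 star.
Proof. by move=> t; rewrite /star !comp_lfun0l add0r addr0. Qed.
Lemma starr0 : right_id 0 star.
Proof. by move=> t; rewrite /star !comp_lfun0r !addr0. Qed.

Definition star_unit t := exists t', star t t' = 0 /\ star t' t = 0.
Definition star_inv t := xget 0 [set t' | star t t' = 0 /\ star t' t = 0].

Lemma star_invP t : star_unit t ->
  star t (star_inv t) = 0 /\ star (star_inv t) t = 0.
Proof. exact: (@xgetPex _ 0 [set t' | star t t' = 0 /\ star t' t = 0]). Qed.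

Lemma star_unit0 : star_unit 0.
Proof. by exists 0; rewrite star0. Qed.
Lemma star_unit_mul t u : star_unit t -> star_unit u -> star_unit (star t u).
Proof.
move=> [t' [h1 h2]] [u' [h3 h4]]; exists (star u' t'); split.
- by rewrite starA -(starA t) h3 starr0.
- by rewrite starA -(starA u') h2 starr0.
Qed.
Lemma star_unit_inv t : star_unit t -> star_unit (star_inv t).
Proof. by move=> /star_invP[h1 h2]; exists t. Qed.

Record autm1 := Autm1 { autm1_val : 'Hom(g0, g1); _ : `[< star_unit autm1_val >] }.

HB.instance Definition _ := [isSub for autm1_val].
HB.instance Definition _ := [Choice of autm1 by <:].

Lemma autm1P (u : autm1) : star_unit (autm1_val u).
Proof. by case: u => u /= /asboolP. Qed.

Definition mk_autm1 t (ht : star_unit t) : autm1 := Autm1 (asboolT ht).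

Definition autm1_one : autm1 := mk_autm1 star_unit0.
Definition autm1_mul (u v : autm1) : autm1 :=
  mk_autm1 (star_unit_mul (autm1P u) (autm1P v)).
Definition autm1_inv (u : autm1) : autm1 := mk_autm1 (star_unit_inv (autm1P u)).

Fact autm1_mulA : associative autm1_mul.
Proof. by move=> u v w; apply/val_inj/starA. Qed.
Fact autm1_mul1 : left_id autm1_one autm1_mul.
Proof. by move=> u; apply/val_inj/star0. Qed.
Fact autm1_mulr1 : right_id autm1_one autm1_mul.
Proof. by move=> u; apply/val_inj/starr0. Qed.
Fact autm1_mulV : left_inverse autm1_one autm1_inv autm1_mul.
Proof. by move=> u; apply/val_inj; exact: (star_invP (autm1P u)).2. Qed.
Fact autm1_mulrV : right_inverse autm1_one autm1_inv autm1_mul.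
Proof. by move=> u; apply/val_inj; exact: (star_invP (autm1P u)).1. Qed.

HB.instance Definition _ :=
  isGroup.Build autm1 autm1_mulA autm1_mul1 autm1_mulr1 autm1_mulV autm1_mulrV.

End Aut.

Record crossedModule := CrossedModule {
  cm1 : groupType;
  cm0 : groupType;
  cm_bd : cm1 -> cm0;
  cm_act : cm0 -> cm1 -> cm1;
  cm_bdM : {morph cm_bd : u v / (u * v)%g};
  cm_act1 : forall u, cm_act 1%g u = u;
  cm_actM : forall A B u, cm_act (A * B)%g u = cm_act A (cm_act B u);
  cm_actMr : forall A, {morph cm_act A : u v / (u * v)%g};
  cm_equivariant : forall A u,
    cm_bd (cm_act A u) = (A * cm_bd u * A^-1)%g;
  cm_peiffer : forall u v, cm_act (cm_bd u) v = (u * v * u^-1)%g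
}.

Definition subgroup (G : groupType) (H : set G) : Prop :=
  [/\ H 1%g, forall x y, H x -> H y -> H (x * y)%g &
      forall x, H x -> H (x^-1)%g].

Definition sub_crossed_module (X : crossedModule)
    (N1 : set (cm1 X)) (N0 : set (cm0 X)) : Prop :=
  [/\ subgroup N1, subgroup N0,
      forall u, N1 u -> N0 (cm_bd u) &
      forall A u, N0 A -> N1 u -> N1 (cm_act A u)].

Definition normal_sub_crossed_module (X : crossedModule)
    (N1 : set (cm1 X)) (N0 : set (cm0 X)) : Prop :=
  [/\ sub_crossed_module N1 N0,
      forall A B, N0 B -> N0 (A * B * A^-1)%g,
      forall A u, N1 u -> N1 (cm_act A u) &
      forall B u, N0 B -> N1 (cm_act B u * u^-1)%g].

Section AutCrossedModule.
Variables (R : realType) (g0 g1 : vectType R) (g : lie2Algebra g0 g1).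
Local Notation d := (ldiff g).
Local Notation br0 := (br0 g).
Local Notation br1 := (br1 g).
Local Notation l3 := (l3 g).
Local Notation triple := (triple g0 g1).
Local Notation star := (star g).
Local Notation is_aut0 := (is_aut0 g).
Implicit Types (A B : triple) (t u : 'Hom(g0, g1)) (x y z : g0) (a b : g1).

Lemma l3_cyc x y z : l3 x y z = l3 z x y.
Proof. by rewrite l3_skew23 l3_skew12 opprK. Qed.

Definition boundary t : triple :=
  (\1%VF + (d \o t)%VF, \1%VF + (t \o d)%VF,
   bilin (fun x y => t (br0 x y) - br1 x (t y) - (- br1 y (t x))
                     - (- br1 (d (t y)) (t x)))).

Lemma c0_boundary t x : c0 (boundary t) x = x + d (t x).
Proof. by rewrite /c0 /= !lfE. Qed.
Lemma c1_boundary t a : c1 (boundary t) a = a + t (d a).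
Proof. by rewrite /c1 /= !lfE. Qed.
Lemma c2_boundary t x y : c2 (boundary t) x y =
  t (br0 x y) - br1 x (t y) - (- br1 y (t x)) - (- br1 (d (t y)) (t x)).
Proof. by rewrite /c2 /boundary /=; lfun_bilin. Qed.
Definition boundaryE := (c0_boundary, c1_boundary, c2_boundary).

Let br0_dl a x : br0 (d a) x = - d (br1 x a).
Proof. by rewrite br0_skew ldiff_br1. Qed.
Let br0_dr a x : br0 x (d a) = d (br1 x a).
Proof. by rewrite ldiff_br1. Qed.

Lemma boundary_aut0 t : star_unit g t -> is_aut0 (boundary t).
Proof.
case=> u [tu ut].
have inv0 v w : star v w = 0 -> cancel (c0 (boundary w)) (c0 (boundary v)).
  move=> h x; have := congr1 (fun f : 'Hom(g0, g1) => d (f x)) h.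
  rewrite /= starE !boundaryE zero_lfunE => {}h.
  by lfun_lin.
have inv1 v w : star v w = 0 -> cancel (c1 (boundary w)) (c1 (boundary v)).
  move=> h a; have := congr1 (fun f : 'Hom(g0, g1) => f (d a)) h.
  rewrite /= starE !boundaryE zero_lfunE => {}h.
  by lfun_lin.
split.
- by exists (c0 (boundary u)); exact: inv0.
- by exists (c1 (boundary u)); exact: inv1.
- by move=> a; rewrite !boundaryE; lfun_ring.
- move=> x y; rewrite !boundaryE (br0_skew g y x) (br1_ldiff g (t y)).
  by lfun_ring.
- move=> x y; rewrite !boundaryE !(lfunD, lfunN, add_lfunE).
  rewrite !(br0_dl, br0_dr) (br1_ldiff g (t y)).
  by lfun_ring.
- move=> x a; rewrite !boundaryE !(lfunD, lfunN, add_lfunE).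
  rewrite !(br0_dl, br0_dr) (br1_ldiff g a) (br1_ldiff g (t (d a))).
  by lfun_ring.
move=> x y z; rewrite !boundaryE.
have j0 := congr1 t (jacobi0 g x y z).
have j1 := jacobi1 g x y (t z).
have j2 := jacobi1 g y z (t x).
have j3 := jacobi1 g z x (t y).
have k1 := jacobi1 g z (d (t x)) (t y).
have k2 := jacobi1 g x (d (t y)) (t z).
have k3 := jacobi1 g y (d (t z)) (t x).
have m := jacobi1 g (d (t x)) (d (t y)) (t z).
rewrite l3_cyc in j2; rewrite 2!l3_cyc in j3.
rewrite 2!l3_cyc in k1; rewrite l3_cyc in k3.
have flip := (br1_ldiff g (t z) (t y), br1_ldiff g (t y) (t x),
  br1_ldiff g (t z) (t x), fun p q => br1_ldiff g (br1 p q)).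
rewrite ?(br0_dl, br0_dr, flip) in j0 j1 j2 j3 k1 k2 k3 m.
rewrite !(lfunD, lfunN, add_lfunE) !(br0_dl, br0_dr, flip).
rewrite !lfunN !opprK flip in m.
by lfun_lin.
Qed.

Lemma boundary_star t u :
  boundary (star t u) = triple_mul (boundary t) (boundary u).
Proof.
apply: tripleP => [x|a|x y].
- by rewrite c0M !c0_boundary starE; lfun_ring.
- by rewrite c1M !c1_boundary starE; lfun_ring.
rewrite c2M !boundaryE !starE !(lfunD, lfunN, add_lfunE).
rewrite !(br0_dl, br0_dr) !(lfunD, lfunN, add_lfunE).
rewrite !(br1_ldiff g (t y), br1_ldiff g (u y), br1_ldiff g (t (d (u y)))).
by lfun_ring.
Qed.

Definition act A t : 'Hom(g0, g1) := (c1 A \o t \o (c0 A)^-1)%VF.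

Lemma actE A t x : act A t x = c1 A (t ((c0 A)^-1%VF x)).
Proof. by rewrite !comp_lfunE. Qed.

Lemma act_star A t u : is_aut0 A -> act A (star t u) = star (act A t) (act A u).
Proof.
move=> hA; apply/lfunP => x; rewrite actE !starE !actE !lfunD.
by rewrite -(aut0_d hA) (bij_lfunK (aut0_bij0 hA)).
Qed.

Lemma act_unit A t : is_aut0 A -> star_unit g t -> star_unit g (act A t).
Proof.
move=> hA [u [tu ut]]; exists (act A u); rewrite -!act_star // tu ut.
by split; rewrite /act comp_lfun0r comp_lfun0l.
Qed.

Lemma act_mul A B t : is_aut0 A -> is_aut0 B ->
  act (triple_mul A B) t = act A (act B t).
Proof.
move=> hA hB; have b0 := aut0_bij0 (is_aut0_mul hA hB).
apply/lfunP => x; rewrite !actE c1M; congr (c1 A (c1 B (t _))).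
apply: (bij_inj b0); rewrite (bij_lfunVK b0) c0M.
by rewrite (bij_lfunVK (aut0_bij0 hB)) (bij_lfunVK (aut0_bij0 hA)).
Qed.

Lemma boundary_act A t : is_aut0 A ->
  triple_mul (boundary (act A t)) A = triple_mul A (boundary t).
Proof.
move=> hA; have K0 := bij_lfunK (aut0_bij0 hA).
have K1 := bij_lfunK (aut0_bij1 hA); have V1 := bij_lfunVK (aut0_bij1 hA).
apply: tripleP => [x|a|x y].
- by rewrite !c0M !c0_boundary actE K0 lfunD (aut0_d hA).
- by rewrite !c1M !c1_boundary actE -(aut0_d hA) K0 lfunD.
rewrite !c2M !boundaryE !actE !K0 -!(aut0_d hA).
have b p a : br1 (c0 A p) (c1 A a) = c1 A (br1 p a) - c2 A p (d a).
  by rewrite -(aut0_br1 hA); lfun_ring.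
have -> : br0 (c0 A x) (c0 A y) = c0 A (br0 x y) - d (c2 A x y).
  by rewrite -(aut0_br0 hA); lfun_ring.
rewrite !b (aut0_skew hA y) (aut0_skew hA (d (t y))) !lfE K0.
by lfun_ring.
Qed.

Lemma act_boundary t u : star_unit g t ->
  star (act (boundary t) u) t = star t u.
Proof.
move=> ht; have b0 := aut0_bij0 (boundary_aut0 ht).
apply/lfunP => x; rewrite !starE.
have -> : t x + u x + t (d (u x)) = t x + c1 (boundary t) (u x).
  by rewrite c1_boundary addrA.
by rewrite !actE addrAC -!lfunD -c0_boundary (bij_lfunK b0) addrC.
Qed.

Lemma act1 t : act (triple1 g0 g1) t = t.
Proof.
have b0 := aut0_bij0 (is_aut0_1 g).
have e x : c0 (triple1 g0 g1) x = x by rewrite /c0 /= id_lfunE.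
apply/lfunP => x; rewrite actE /c1 /= id_lfunE -[x in LHS]e.
by rewrite (bij_lfunK b0).
Qed.

Definition aut_bd (u : autm1 g) : aut0 g :=
  mk_aut0 (boundary_aut0 (autm1P u)).

Definition aut_act (A : aut0 g) (u : autm1 g) : autm1 g :=
  mk_autm1 (act_unit (aut0P A) (autm1P u)).

Implicit Types (C : aut0 g) (v w : autm1 g).

Fact aut_bdM : {morph aut_bd : v w / (v * w)%g}.
Proof. by move=> v w; apply/val_inj/boundary_star. Qed.

Fact aut_act1 v : aut_act 1%g v = v.
Proof. by apply/val_inj/act1. Qed.

Fact aut_actM (C C' : aut0 g) v : aut_act (C * C')%g v = aut_act C (aut_act C' v).
Proof. by apply/val_inj/act_mul; exact: aut0P. Qed.

Fact aut_actMr C : {morph aut_act C : v w / (v * w)%g}.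
Proof. by move=> v w; apply/val_inj/act_star/aut0P. Qed.

Fact aut_equivariant C v : aut_bd (aut_act C v) = (C * aut_bd v * C^-1)%g.
Proof.
apply: (mulIg C); rewrite mulgVK.
by apply/val_inj/boundary_act/aut0P.
Qed.

Fact aut_peiffer v w : aut_act (aut_bd v) w = (v * w * v^-1)%g.
Proof.
apply: (mulIg v); rewrite mulgVK.
by apply/val_inj/act_boundary/autm1P.
Qed.

Definition aut : crossedModule :=
  CrossedModule aut_bdM aut_act1 aut_actM aut_actMr aut_equivariant aut_peiffer.

End AutCrossedModule.

(* G is a Lie group realised inside a finite-dimensional vector space E by
   iota : G -> E, so that tangent vectors at 1 are elements of E. The topology
   of E is the unique Hausdorff vector space topology: a curve in E has
   velocity X at 0 when its image under every linear functional phi has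
   derivative phi X there. A homomorphism R -> G that is differentiable at 0
   is smooth. *)
Section LieSubgroup.
Variables (R : realType) (G : groupType) (E : vectType R) (iota : G -> E).

Definition one_parameter_subgroup (c : R -> G) (X : E) : Prop :=
  (forall s t : R, c (s + t) = (c s * c t)%g) /\
  (forall phi : {linear E -> R^o},
     is_derive (0 : R) (1 : R) (fun t : R => phi (iota (c t)) : R) (phi X : R)).

(* is_exp X x says that x is the Lie group exponential of X. *)
Definition is_exp (X : E) (x : G) : Prop :=
  exists2 c : R -> G, one_parameter_subgroup c X & c 1 = x.

(* The connected Lie subgroup of G with a given Lie algebra h consists of the
   finite products of exponentials of elements of h, i.e. it is the subgroup
   generated by them. *)
Definition connected_lie_subgroup (h : set E) : set G :=
  smallest (@subgroup G) [set x | exists2 X, h X & is_exp X x].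

End LieSubgroup.

Section Derivations.
Variables (R : realType) (g0 g1 : vectType R) (g : lie2Algebra g0 g1).
Local Notation d := (ldiff g).
Local Notation br0 := (br0 g).
Local Notation br1 := (br1 g).
Local Notation l3 := (l3 g).
Local Notation triple := (triple g0 g1).
Implicit Types (A B X : triple) (t : 'Hom(g0, g1)) (x y z : g0) (a b : g1).

Record is_der0 X : Prop := IsDer0 {
  der0_d : forall a, c0 X (d a) = d (c1 X a);
  der0_skew : forall x y, c2 X x y = - c2 X y x;
  der0_br0 : forall x y,
    d (c2 X x y) = c0 X (br0 x y) - br0 (c0 X x) y - br0 x (c0 X y);
  der0_br1 : forall x a,
    c2 X x (d a) = c1 X (br1 x a) - br1 (c0 X x) a - br1 x (c1 X a);
  der0_l3 : forall x y z,
    c1 X (l3 x y z) =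
      (c2 X x (br0 y z) + br1 x (c2 X y z) + l3 (c0 X x) y z)
      + (c2 X y (br0 z x) + br1 y (c2 X z x) + l3 (c0 X y) z x)
      + (c2 X z (br0 x y) + br1 z (c2 X x y) + l3 (c0 X z) x y)
}.

Definition dbar t : triple :=
  ((d \o t)%VF, (t \o d)%VF,
   bilin (fun x y => t (br0 x y) - br1 x (t y) - (- br1 y (t x)))).

Definition ad0 x : triple := (br0 x, br1 x, l3 x).

(* inn^0 = Im ad0 + Im dbar *)
Definition inn0 : set triple := [set X | exists x t, X = ad0 x + dbar t].
Definition innm1 : set 'Hom(g0, g1) := setT.

Lemma c2_dbar t x y :
  c2 (dbar t) x y = t (br0 x y) - br1 x (t y) - (- br1 y (t x)).
Proof. by rewrite /c2 /dbar /=; lfun_bilin. Qed.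

Lemma der0D X Y : is_der0 X -> is_der0 Y -> is_der0 (X + Y).
Proof.
move=> hX hY.
have e0 x : c0 (X + Y) x = c0 X x + c0 Y x by rewrite -add_lfunE.
have e1 a : c1 (X + Y) a = c1 X a + c1 Y a by rewrite -add_lfunE.
have e2 x y : c2 (X + Y) x y = c2 X x y + c2 Y x y.
  by rewrite -!add_lfunE.
split=> *; rewrite !(e0, e1, e2).
- by rewrite (der0_d hX) (der0_d hY) lfunD.
- by rewrite (der0_skew hX) (der0_skew hY) opprD.
- by rewrite lfunD (der0_br0 hX) (der0_br0 hY); lfun_ring.
- by rewrite (der0_br1 hX) (der0_br1 hY); lfun_ring.
- by rewrite (der0_l3 hX) (der0_l3 hY); lfun_ring.
Qed.

Lemma der0_ad0 x : is_der0 (ad0 x).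
Proof.
split; rewrite /c0 /c1 /c2 /=.
- by move=> a; rewrite ldiff_br1.
- by move=> y z; exact: l3_skew23.
- move=> y z; have := jacobi0 g x y z.
  rewrite (br0_skew g (br0 y z)) (br0_skew g z x) (br0_skew g (- br0 x z)).
  by move=> h; lfun_lin.
- by move=> y a; have h := jacobi1 g x y a; lfun_lin.
- move=> y z w; have h := l3_coherence g x y z w.
  rewrite !(l3_cyc g _ _ (br0 _ _)) (l3_skew23 g x w y)
    (l3_skew23 g _ w y) (br0_skew g w y).
  by lfun_lin.
Qed.

Lemma der0_dbar t : is_der0 (dbar t).
Proof.
have e0 x : c0 (dbar t) x = d (t x) by rewrite -comp_lfunE.
have e1 a : c1 (dbar t) a = t (d a) by rewrite -comp_lfunE.
split.
- by move=> a; rewrite e0 e1.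
- by move=> x y; rewrite !c2_dbar (br0_skew g y x); lfun_ring.
- move=> x y; rewrite c2_dbar !e0 (br0_skew g (d _)) !(lfunD, lfunN).
  by rewrite !ldiff_br1; lfun_ring.
- move=> x a; rewrite c2_dbar e0 !e1 ldiff_br1 (br1_ldiff g a).
  by lfun_ring.
move=> x y z; rewrite !e0 !e1 !c2_dbar.
have j0 := congr1 t (jacobi0 g x y z).
rewrite !(br0_skew g (br0 _ _)) in j0.
have j1 := jacobi1 g x y (t z).
have j2 := jacobi1 g y z (t x).
have j3 := jacobi1 g z x (t y).
rewrite l3_cyc in j1; rewrite l3_cyc in j2; rewrite l3_cyc in j3.
by lfun_lin.
Qed.

Lemma inn0_der0 : inn0 `<=` is_der0.
Proof.
by move=> X [x [t ->]]; apply: der0D; [exact: der0_ad0|exact: der0_dbar].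
Qed.

(* The tangent spaces at 1 of Aut^0 and Aut^{-1} are the subspaces Der^0 of
   triple and Der^{-1} = 'Hom(g0, g1): the unit of Aut^{-1} is the zero map. *)
Definition Inn0 : set (aut0 g) := connected_lie_subgroup (@aut0_val _ _ _ g) inn0.
Definition Innm1 : set (autm1 g) :=
  connected_lie_subgroup (@autm1_val _ _ _ g) innm1.

End Derivations.

Arguments Inn0 {R g0 g1} g _.
Arguments Innm1 {R g0 g1} g _.

(* Main.v *)
(* Inn^0 and Inn^{-1} are generated by exponentials, so that everything but the
   last condition of normality comes from differentiating, at 0, the images of
   one-parameter subgroups under the boundary, the action and conjugation. In
   particular Ad_A maps ad0 x + dbar t to
   ad0 (A_0 x) + dbar (A_2(x, A_0^-1 -) + act A t).

   For the last condition, the displacement m |-> (m |> h) h^-1 is a cocycle: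
   along a one-parameter subgroup c, the displacement by c 1 is a product of
   images, under elements of Aut^0, of the displacement by c (1 / n). It
   therefore suffices that Inn^{-1} contains a neighbourhood of the identity,
   which needs neither the matrix exponential nor the logarithm. If
   r d r = lam r with 1 + lam > 0, in particular if r has rank one and is small,
   then r is an exponential, by an explicit formula involving only the scalar
   exponential; and Gaussian elimination on columns writes every small element
   of Hom(g0, g_{-1}) as a star-product of such r. *)

Require Import Defs.
From mathcomp Require Import all_boot all_algebra reals.
From HB Require Import structures.
From mathcomp Require Import all_order.
From mathcomp Require Import boolp classical_sets functions topology normedtype.
From mathcomp Require Import sequences derive realfun exp.
From mathcomp Require Import zify ring lra.
Import Order.TTheory GRing.Theory Num.Theory.
Import numFieldNormedType.Exports.

Set Implicit Arguments.
Unset Strict Implicit.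
Unset Printing Implicit Defensive.

Local Open Scope classical_set_scope.
Local Open Scope ring_scope.

(** * Velocities at [0] of curves in a finite-dimensional vector space *)

Section Velocity.
Variable R : realType.
Implicit Types U V W : vectType R.

(** Differentiability is tested through linear functionals, so that the second clause of
    [one_parameter_subgroup] is [has_velocity] of [iota \o c] by unfolding. *)
Definition has_velocity V (u : R -> V) (X : V) : Prop :=
  forall phi : {linear V -> R^o},
    is_derive (0 : R) (1 : R) (fun s : R => phi (u s) : R) (phi X : R).

Lemma has_velocity_functional V (u : R -> V) X (phi : V -> R^o) :
  has_velocity u X -> linear phi ->
  is_derive (0 : R) (1 : R) (fun s : R => phi (u s) : R) (phi X : R).
Proof.
move=> hu lphi.
exact: (hu (HB.pack phi (GRing.isLinear.Build R V R^o *:%R phi lphi))).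
Qed.

Lemma has_velocity_linear U V (f : U -> V) u X :
  linear f -> has_velocity u X -> has_velocity (fun s => f (u s)) (f X).
Proof.
move=> lf hu phi.
apply: (has_velocity_functional (phi := fun x => phi (f x))) => //.
by move=> a x y; rewrite lf linearP.
Qed.

Lemma has_velocity_homo U V (f : 'Hom(U, V)) u X :
  has_velocity u X -> has_velocity (fun s => f (u s)) (f X).
Proof. exact/has_velocity_linear/linearP. Qed.

Lemma has_velocity_cst V (x : V) : has_velocity (fun=> x) 0.
Proof. by move=> phi; rewrite linear0; exact: is_derive_cst. Qed.

Lemma has_velocityD V (u v : R -> V) X Y :
  has_velocity u X -> has_velocity v Y ->
  has_velocity (fun s => u s + v s) (X + Y).
Proof.
move=> hu hv phi; rewrite linearD.
rewrite (_ : (fun s => _) =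
  (fun s : R => phi (u s) : R) + (fun s : R => phi (v s) : R)).
  by apply: is_deriveD; [exact: hu|exact: hv].
by apply/funext => s; rewrite linearD.
Qed.

Lemma has_velocity_eq V (u v : R -> V) X Y :
  has_velocity u X -> u =1 v -> X = Y -> has_velocity v Y.
Proof. by move=> h /funext <- <-. Qed.

Lemma sum_has_velocity V n (u : 'I_n -> R -> V) X :
  (forall i, has_velocity (u i) (X i)) ->
  has_velocity (fun s => \sum_i u i s) (\sum_i X i).
Proof.
move=> h phi; rewrite linear_sum.
rewrite (_ : (fun s => _) = \sum_i (fun s : R => phi (u i s) : R)).
  by apply: is_derive_sum => i; exact: h.
by apply/funext => s; rewrite linear_sum fct_sumE.
Qed.

Lemma has_velocity_scale V (f : R -> R) (df : R) (u : R -> V) X :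
  is_derive (0 : R) (1 : R) f df -> has_velocity u X ->
  has_velocity (fun s => f s *: u s) (f 0 *: X + df *: u 0).
Proof.
move=> hf hu phi.
rewrite (_ : (fun s => _) = f * (fun s : R => phi (u s) : R)).
  apply: (is_derive_eq (is_deriveM hf (hu phi))).
  by rewrite linearD !linearZ /= [_ *: df]mulrC.
by apply/funext => s; rewrite linearZ.
Qed.

(** Expanding the second argument in a basis makes [B] a finite sum of scalar curves times vector
    curves, so the scalar product rule suffices. *)
Lemma has_velocity_bilinear U V W (B : U -> V -> W) u v X Y :
  (forall x, linear (B x)) -> (forall y, linear (B^~ y)) ->
  has_velocity u X -> has_velocity v Y ->
  has_velocity (fun s => B (u s) (v s)) (B X (v 0) + B (u 0) Y).
Proof.
move=> l1 l2 hu hv.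
have Bsum x y : B x y =
    \sum_i coord (vbasis {:V}) i y *: B x (vbasis {:V})`_i.
  rewrite -[LHS](linfunE (l1 x)) {1}(coord_vbasis (memvf y)) linear_sum.
  by apply: eq_bigr => i _; rewrite linearZ /= (linfunE (l1 x)).
have hc i : is_derive (0 : R) (1 : R)
    (fun s : R => coord (vbasis {:V}) i (v s)) (coord (vbasis {:V}) i Y).
  exact: (hv (coord (vbasis {:V}) i)).
apply: has_velocity_eq (sum_has_velocity (fun i => has_velocity_scale (hc i)
  (has_velocity_linear (l2 (vbasis {:V})`_i) hu))) _ _ => [s|] /=.
  by rewrite Bsum.
by rewrite big_split /= -!Bsum.
Qed.

Lemma has_velocity_eval U V (u : R -> 'Hom(U, V)) X x :
  has_velocity u X -> has_velocity (fun s => u s x) (X x).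
Proof.
apply: (has_velocity_linear (f := fun f : 'Hom(U, V) => f x)) => a f f'.
by rewrite add_lfunE scale_lfunE.
Qed.

Lemma has_velocity_app U V (u : R -> 'Hom(U, V)) X (v : R -> U) Y :
  has_velocity u X -> has_velocity v Y ->
  has_velocity (fun s => u s (v s)) (X (v 0) + u 0 Y).
Proof.
apply: (has_velocity_bilinear (B := fun (f : 'Hom(U, V)) x => f x)).
- by move=> f; exact: linearP.
- by move=> y a f f'; rewrite add_lfunE scale_lfunE.
Qed.

(** A linear map is the sum of the rank-one maps [P i] built from its values on a basis, and [P i]
    is linear in the value. *)
Lemma has_velocity_lfun U V (u : R -> 'Hom(U, V)) (X : 'Hom(U, V)) :
  (forall x, has_velocity (fun s => u s x) (X x)) -> has_velocity u X.
Proof.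
move=> h.
pose P i : V -> 'Hom(U, V) :=
  fun y => linfun (fun x => coord (vbasis {:U}) i x *: y).
have PE i y x : P i y x = coord (vbasis {:U}) i x *: y.
  by rewrite linfunE // => a x' x''; rewrite linearP scalerDl scalerA.
have lP i : linear (P i).
  move=> a y y'; apply/lfunP => x.
  by rewrite add_lfunE scale_lfunE !PE scalerDr !scalerA mulrC.
have decomp (f : 'Hom(U, V)) : f = \sum_i P i (f (vbasis {:U})`_i).
  apply/lfunP => x; rewrite {1}(coord_vbasis (memvf x)) linear_sum sum_lfunE.
  by apply: eq_bigr => i _; rewrite linearZ PE.
apply: has_velocity_eq (sum_has_velocity (fun i => has_velocity_linear (lP i)
  (h (vbasis {:U})`_i))) _ _ => [s|] /=; by rewrite -decomp.
Qed.

Lemma has_velocity_pair U V (u : R -> U) (v : R -> V) X Y :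
  has_velocity u X -> has_velocity v Y ->
  has_velocity (fun s => (u s, v s) : (U * V)%type) (X, Y).
Proof.
move=> hu hv.
have l1 : linear (fun x : U => (x, 0 : V)).
  by move=> a x y; congr pair; rewrite /= scaler0 addr0.
have l2 : linear (fun y : V => (0 : U, y)).
  by move=> a x y; congr pair; rewrite /= scaler0 addr0.
apply: has_velocity_eq (has_velocityD (has_velocity_linear l1 hu)
  (has_velocity_linear l2 hv)) _ _ => [s|] /=;
  by congr pair; rewrite /= ?addr0 ?add0r.
Qed.

Lemma has_velocity_opp V (u : R -> V) X :
  has_velocity u X -> has_velocity (fun s => u (- s)) (- X).
Proof.
move=> hu phi.
have e : is_derive (- (0 : R)) (1 : R) (fun s : R => phi (u s) : R) (phi X : R).
  by rewrite oppr0; exact: hu.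
have e' : is_derive (0 : R) (1 : R) (-%R : R -> R) (-1) by apply: is_deriveNid.
apply: is_derive_eq (is_derive1_comp e e') _.
by rewrite mulrN1 linearN.
Qed.

Lemma has_velocity_cvg V (u : R -> V) X (phi : V -> R^o) :
  has_velocity u X -> linear phi ->
  ((phi (u s) : R) @[s --> (0 : R)] --> (phi (u 0) : R)).
Proof.
move=> hu lphi; have [h _] := has_velocity_functional hu lphi.
by have /derivable1_diffP/differentiable_continuous := h.
Qed.

End Velocity.

(** * Connected Lie subgroups and their behaviour under homomorphisms *)

Section ConnectedLieSubgroup.
Variables (R : realType) (G : groupType) (E : vectType R) (iota : G -> E).
Implicit Types (h : set E) (N : set G).

Lemma connected_lie_subgroup_subgroup h :
  subgroup (connected_lie_subgroup iota h).
Proof.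
split=> [N [[]]//|x y hx hy N NP|x hx N NP]; have [[N1 NM NV] _] := NP.
- by apply: NM; [exact: hx|exact: hy].
- by apply: NV; exact: hx.
Qed.

Lemma connected_lie_subgroup_exp h X x :
  h X -> is_exp iota X x -> connected_lie_subgroup iota h x.
Proof. by move=> hX Xx; apply: sub_gen_smallest; exists X. Qed.

Lemma connected_lie_subgroup_sub h N : subgroup N ->
  (forall X x, h X -> is_exp iota X x -> N x) ->
  connected_lie_subgroup iota h `<=` N.
Proof.
by move=> Ngrp hN; apply: smallest_sub => // x [X hX Xx]; exact: hN Xx.
Qed.

Lemma one_parameter_subgroup0 (c : R -> G) X :
  one_parameter_subgroup iota c X -> c 0 = 1%g.
Proof.
by move=> [cD _]; apply: (mulgI (c 0)); rewrite -cD addr0 mulg1.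
Qed.

Lemma one_parameter_subgroupN (c : R -> G) X s :
  one_parameter_subgroup iota c X -> c (- s) = ((c s)^-1)%g.
Proof.
move=> hc; have [cD _] := hc; apply: (mulIg (c s)).
by rewrite mulVg -cD addNr (one_parameter_subgroup0 hc).
Qed.

End ConnectedLieSubgroup.

Section GroupMorphism.
Variables (G H : groupType) (f : G -> H).
Hypothesis fM : {morph f : x y / (x * y)%g}.

Lemma group_morph1 : f 1%g = 1%g.
Proof. by apply: (mulgI (f 1%g)); rewrite -fM !mulg1. Qed.

Lemma group_morphV x : f (x^-1)%g = ((f x)^-1)%g.
Proof. by apply: (mulIg (f x)); rewrite -fM !mulVg group_morph1. Qed.

Lemma subgroup_preimage (N : set H) : subgroup N -> subgroup [set x | N (f x)].
Proof.
move=> [N1 NM NV]; split=> [|x y /= Nx Ny|x /= Nx].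
- by rewrite /= group_morph1.
- by rewrite fM; exact: NM.
- by rewrite group_morphV; exact: NV.
Qed.

End GroupMorphism.

(** A homomorphism carries one-parameter subgroups to one-parameter subgroups, hence exponentials to
    exponentials; only the velocity of the image has to be identified. Boundary, action and
    conjugation all go through this lemma. *)
Lemma connected_lie_subgroup_morph (R : realType) (G H : groupType)
    (E F : vectType R) (iota : G -> E) (kappa : H -> F) (f : G -> H)
    (h : set E) (k : set F) :
  {morph f : x y / (x * y)%g} ->
  (forall X c, h X -> one_parameter_subgroup iota c X ->
     exists2 Y, k Y & has_velocity (fun s => kappa (f (c s))) Y) ->
  forall x,
    connected_lie_subgroup iota h x -> connected_lie_subgroup kappa k (f x).
Proof.
move=> fM hf.
apply: connected_lie_subgroup_sub.
  exact: subgroup_preimage (connected_lie_subgroup_subgroup _ _).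
move=> X x hX [c hc <-]; have [Y kY vY] := hf X c hX hc.
apply: connected_lie_subgroup_exp kY _; exists (f \o c) => //; split=> // s t.
by rewrite /= hc.1 fM.
Qed.

(** * Velocities in the space of triples: boundary and conjugation *)

Section Triple.
Variables (R : realType) (g0 g1 : vectType R).
Implicit Types (X : triple g0 g1).

Lemma linear_c0 : linear (@c0 R g0 g1). Proof. by []. Qed.
Lemma linear_c1 : linear (@c1 R g0 g1). Proof. by []. Qed.
Lemma linear_c2 : linear (@c2 R g0 g1). Proof. by []. Qed.

Lemma has_velocity_triple (u : R -> triple g0 g1) X :
  (forall x, has_velocity (fun s => c0 (u s) x) (c0 X x)) ->
  (forall a, has_velocity (fun s => c1 (u s) a) (c1 X a)) ->
  (forall x y, has_velocity (fun s => c2 (u s) x y) (c2 X x y)) ->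
  has_velocity u X.
Proof.
move=> h0 h1 h2.
have h := has_velocity_pair (has_velocity_pair (has_velocity_lfun h0)
  (has_velocity_lfun h1))
  (has_velocity_lfun (fun x => has_velocity_lfun (h2 x))).
apply: (has_velocity_eq h) => [s|].
- by rewrite /c0 /c1 /c2; case: (u s) => [[]].
- by rewrite /c0 /c1 /c2; case: X {h h0 h1 h2} => [[]].
Qed.

End Triple.

Section InnerExponentials.
Variables (R : realType) (g0 g1 : vectType R) (g : lie2Algebra g0 g1).
Local Notation d := (ldiff g).
Local Notation br0 := (br0 g).
Local Notation br1 := (br1 g).
Local Notation l3 := (l3 g).
Implicit Types (A : triple g0 g1) (t : 'Hom(g0, g1)) (x y z : g0) (a : g1).

Lemma c0_inner x t y : c0 (ad0 g x + dbar g t) y = br0 x y + d (t y).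
Proof. by rewrite [LHS]add_lfunE /c0 /= comp_lfunE. Qed.

Lemma c1_inner x t a : c1 (ad0 g x + dbar g t) a = br1 x a + t (d a).
Proof. by rewrite [LHS]add_lfunE /c1 /= comp_lfunE. Qed.

Lemma c2_inner x t y z : c2 (ad0 g x + dbar g t) y z =
  l3 x y z + (t (br0 y z) - br1 y (t z) + br1 z (t y)).
Proof.
rewrite -[X in _ = _ + (_ + X)]opprK -c2_dbar.
by rewrite -!add_lfunE.
Qed.

(** The summand [ad0 g 0] is zero; it puts the velocity in the shape required by [inn0]. *)
Lemma boundary_velocity (u : R -> 'Hom(g0, g1)) t :
  u 0 = 0 -> has_velocity u t ->
  has_velocity (fun s => boundary g (u s)) (ad0 g 0 + dbar g t).
Proof.
move=> u0 hu; have hx x : has_velocity (fun s => u s x) (t x).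
  exact: has_velocity_eval.
apply: has_velocity_triple => [x|a|x y].
- have h := has_velocityD (has_velocity_cst x) (has_velocity_homo d (hx x)).
  apply: (has_velocity_eq h) => [s|] /=.
    by rewrite c0_boundary.
  by rewrite c0_inner !lfE.
- have h := has_velocityD (has_velocity_cst a) (hx (d a)).
  apply: (has_velocity_eq h) => [s|] /=.
    by rewrite c1_boundary.
  by rewrite c1_inner !lfE.
(* The quadratic term contributes nothing, since both factors vanish at [0]. *)
have hq : has_velocity (fun s => br1 (d (u s y)) (u s x)) 0.
  have := has_velocity_app (has_velocity_homo (br1 \o d)%VF (hx y)) (hx x).
  by rewrite u0 !lfE addr0 => /has_velocity_eq; apply=> // s; rewrite !lfE.
have h := has_velocityD (has_velocityD (has_velocityD (hx (br0 x y))
  (has_velocity_homo (- br1 x) (hx y))) (has_velocity_homo (br1 y) (hx x))) hq.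
apply: (has_velocity_eq h) => [s|] /=.
  by rewrite c2_boundary !lfE !opprK.
by rewrite c2_inner !lfE add0r addr0.
Qed.

Lemma act_linear A : linear (act A).
Proof.
by move=> k t u; apply/lfunP => x; rewrite !(lfE, actE).
Qed.

(** This is [Ad_A] on [inn^0]. Evaluating at images under [A] cancels the inverses, and the
    equations of [is_aut0] move [A] across the brackets. *)
Lemma conj_velocity A (u : R -> triple g0 g1) x t : is_aut0 g A ->
  u 0 = triple1 g0 g1 -> has_velocity u (ad0 g x + dbar g t) ->
  has_velocity (fun s => triple_mul (triple_mul A (u s)) (triple_inv A))
    (ad0 g (c0 A x) + dbar g ((c2 A x \o (c0 A)^-1)%VF + act A t)).
Proof.
move=> hA u0 hu.
have b0 := aut0_bij0 hA; have b1 := aut0_bij1 hA.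
have K0 := bij_lfunK b0; have V0 := bij_lfunVK b0.
have K1 := bij_lfunK b1; have V1 := bij_lfunVK b1.
have h0 y := has_velocity_eval y (has_velocity_linear (@linear_c0 R g0 g1) hu).
have h1 a := has_velocity_eval a (has_velocity_linear (@linear_c1 R g0 g1) hu).
have h2 y z := has_velocity_eval z
  (has_velocity_eval y (has_velocity_linear (@linear_c2 R g0 g1) hu)).
have surj r : exists q, r = c0 A q by exists ((c0 A)^-1%VF r); rewrite V0.
have d' a : (c0 A)^-1%VF (d a) = d ((c1 A)^-1%VF a).
  by apply: (bij_inj b0); rewrite V0 (aut0_d hA) V1.
have br1A p a : br1 (c0 A p) (c1 A a) = c1 A (br1 p a) - c2 A p (d a).
  by rewrite -(aut0_br1 hA); lfun_ring.
have br0A p q : br0 (c0 A p) (c0 A q) = c0 A (br0 p q) - d (c2 A p q).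
  by rewrite -(aut0_br0 hA); lfun_ring.
apply: has_velocity_triple => [y|a|y z].
- have [v ->] := surj y.
  have h := has_velocity_homo (c0 A) (h0 v).
  apply: (has_velocity_eq h) => [s|] /=; first by rewrite !c0M K0.
  rewrite !c0_inner !lfE ?actE K0 br0A -(aut0_d hA).
  by lfun_ring.
- have -> : a = c1 A ((c1 A)^-1%VF a) by rewrite V1.
  move: (_ a) => {}a.
  have h := has_velocity_homo (c1 A) (h1 a).
  apply: (has_velocity_eq h) => [s|] /=; first by rewrite !c1M K1.
  rewrite !c1_inner !lfE ?actE -(aut0_d hA) K0 br1A.
  by lfun_ring.
have [v ->] := surj y; have [w ->] := surj z.
have hB : has_velocity (fun s => c2 A (c0 (u s) v) (c0 (u s) w))
    (c2 A (br0 x v + d (t v)) w + c2 A v (br0 x w + d (t w))).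
  have := has_velocity_bilinear (B := fun p q => c2 A p q) _ _ (h0 v) (h0 w).
  rewrite u0 /c0 /= !id_lfunE -!/(c0 _) !c0_inner; apply.
    by move=> p; exact: linearP.
  by move=> q k p p'; rewrite !lfE.
have h := has_velocityD (has_velocityD hB (has_velocity_homo (c1 A) (h2 v w)))
  (has_velocity_homo (- c1 A) (h1 ((c1 A)^-1%VF (c2 A v w)))).
apply: (has_velocity_eq h) => [s|].
  by rewrite !c2M c2V c1M !K0 !lfE.
rewrite !(c1_inner, c2_inner) !lfE ?actE !K0 !br0A !lfE !K0 d' !br1A.
rewrite -(aut0_br1 hA x) V1.
(* What is left, up to skew-symmetry, is the compatibility of [A] with [l3]. *)
have l3A := aut0_l3 hA x v w.
rewrite (br0_skew g w x) (aut0_skew hA (- br0 x w)) (aut0_skew hA (br0 v w))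
  (aut0_skew hA w x) in l3A.
rewrite (aut0_skew hA w (d (t v))); clear -l3A.
lfun_lin.
Qed.

End InnerExponentials.

(** * Small elements of [Hom(g0, g_{-1})] lie in [Inn^{-1}] *)

Section InnerUnits.
Variables (R : realType) (g0 g1 : vectType R) (g : lie2Algebra g0 g1).
Local Notation d := (ldiff g).
Local Notation star := (star g).
Implicit Types (r t : 'Hom(g0, g1)) (u : R -> 'Hom(g0, g1)).

Lemma subgroup_Innm1 : subgroup (Innm1 g).
Proof. exact: connected_lie_subgroup_subgroup. Qed.

(** Membership in [Inn^{-1}] for a bare linear map: the elimination runs in ['Hom(g0, g1)], where
    being a unit is not built in. *)
Definition inner_unit t : Prop :=
  exists2 v : autm1 g, autm1_val v = t & Innm1 g v.

Lemma inner_unit0 : inner_unit 0.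
Proof. by exists 1%g => //; have [] := subgroup_Innm1. Qed.

Lemma inner_unit_star t t' :
  inner_unit t -> inner_unit t' -> inner_unit (star t t').
Proof.
move=> [v <- hv] [v' <- hv']; exists (v * v')%g => //.
by have [_ mulP _] := subgroup_Innm1; exact: mulP.
Qed.

Lemma inner_unit_val (v : autm1 g) : inner_unit (autm1_val v) -> Innm1 g v.
Proof. by move=> [w /val_inj ->]. Qed.

Lemma scale_star r (lam k l : R) : (r \o d \o r)%VF = lam *: r ->
  star (k *: r) (l *: r) = (k + l + lam * k * l) *: r.
Proof.
move=> hr; apply/lfunP => x; have := congr1 (fun f : 'Hom(g0, g1) => f x) hr.
rewrite starE !lfE => hx; rewrite hx !scalerA -!scalerDl; congr (_ *: _).
by ring.
Qed.

(* The functional equation says that 1 + lam f is multiplicative. *)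
Lemma scalar_exponential (lam : R) : 0 < 1 + lam ->
  exists f : R -> R, [/\
    forall s t : R, f (s + t) = f s + f t + lam * f s * f t,
    f 1 = 1 & exists df, is_derive (0 : R) (1 : R) f df].
Proof.
move=> lam1; have [->|lam0] := eqVneq lam 0.
  exists id; split=> [s t||]; [by rewrite !mul0r addr0|by []|].
  by exists 1; exact: is_derive_id.
(* Here [1 + lam f] is the power [(1 + lam)^s]; this base is forced by [f 1 = 1]. *)
exists (fun s => (expR (ln (1 + lam) * s) - 1) / lam); split=> [s t||].
- by rewrite mulrDr expRD; field.
- by rewrite mulr1 lnK ?posrE// addrAC subrr add0r divff.
- exists (ln (1 + lam) / lam).
  have dlin : is_derive (0 : R) (1 : R) ( *%R (ln (1 + lam))) (ln (1 + lam)).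
    have := is_deriveZ (ln (1 + lam)) (is_derive_id (0 : R) (1 : R)).
    by rewrite /GRing.scale /= mulr1.
  have dexp := is_derive1_comp (is_derive_expR (ln (1 + lam) * 0)) dlin.
  have := is_deriveZ lam^-1
    (is_deriveB dexp (is_derive_cst (1 : R) (0 : R) (1 : R))).
  rewrite (_ : _ \*: _ = fun s => (expR (ln (1 + lam) * s) - 1) / lam);
    last by apply/funext => s; rewrite /= mulrC.
  by move=> /is_derive_eq; apply; rewrite mulr0 expR0 mul1r subr0 mulrC.
Qed.


(** By [scale_star], the curve [f s *: r] is a one-parameter subgroup; it passes through [r] at time
    [1]. *)
Lemma inner_unit_exp r lam :
  (r \o d \o r)%VF = lam *: r -> 0 < 1 + lam -> inner_unit r.
Proof.
move=> hr lam1; have [f [fD f1 [df hf]]] := scalar_exponential lam1.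
(* Comparing [f (0 + 1)] with [f 1 = 1] gives [(1 + lam) * f 0 = 0], and [1 + lam] is positive. *)
have f0 : f 0 = 0.
  have := fD 0 (-1 + 1); rewrite addNr addr0 => e.
  have := fD (-1) 1; have := fD 0 1; rewrite add0r addNr f1 => e1 e2.
  by nra.
have fr_unit s : star_unit g (f s *: r).
  exists (f (- s) *: r); rewrite !(scale_star _ _ hr) -!fD.
  by rewrite subrr addNr f0 scale0r.
exists (mk_autm1 (fr_unit 1)); first by rewrite /= f1 scale1r.
apply: (connected_lie_subgroup_exp (X := df *: r)) => //.
exists (fun s => mk_autm1 (fr_unit s)) => //; split=> [s t|].
  by apply: val_inj; rewrite /= (scale_star _ _ hr) -fD.
have := has_velocity_scale hf (has_velocity_cst r).
by rewrite scaler0 add0r.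
Qed.

Local Notation e := (vbasis {:g0}).

(** Column elimination by induction on [k], the number of last columns of [u s] that may be nonzero.
    A curve whose coordinates tend to [0] stands in for a neighbourhood of [0]. *)
Lemma inner_unit_near_ker k u :
  (forall x (psi : g1 -> R^o), linear psi ->
     (psi (u s x) : R) @[s --> (0 : R)] --> (0 : R)) ->
  (\forall s \near (0 : R), forall i, (i + k < \dim {:g0})%N -> u s e`_i = 0) ->
  \forall s \near (0 : R), inner_unit (u s).
Proof.
elim: k u => [|k IHk] u hu uker.
  near=> s; suff -> : u s = 0 by exact: inner_unit0.
  apply/lfunP => x.
  rewrite lfE (coord_vbasis (memvf x)) linear_sum big1 // => i _.
  rewrite linearZ /=; have -> : u s e`_i = 0; last by rewrite scaler0.
  have : forall i, (i + 0 < \dim {:g0})%N -> u s e`_i = 0 by near: s.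
  by apply; rewrite addn0.
have [kn|nk] := ltnP k (\dim {:g0}); last first.
  apply: IHk => //; near=> s => i ik.
  by move: ik; rewrite ltnNge (leq_trans nk) ?leq_addl.
(* The first column that may be nonzero; the induction step clears it. *)
pose m := (\dim {:g0} - k.+1)%N.
have mn : (m < \dim {:g0})%N by rewrite /m; lia.
pose im := Ordinal mn.
pose pr : 'End(g0) := linfun (fun x => coord e im x *: e`_m).
have prE x : pr x = coord e im x *: e`_m.
  by rewrite linfunE // => a y z; rewrite linearP scalerDl scalerA.
pose r s := (u s \o pr)%VF.
have rE s x : r s x = coord e im x *: u s e`_m.
  by rewrite comp_lfunE prE linearZ.
pose lam s : R := coord e im (d (u s e`_m)).
have hr s : (r s \o d \o r s)%VF = lam s *: r s.
  apply/lfunP => x; rewrite scale_lfunE !comp_lfunE !prE !linearZ /=.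
  by rewrite scalerA mulrC.
have coord_d : linear (fun b => coord e im (d b) : R^o).
  by move=> a b c; rewrite !lfE linearP.
have lam_cvg : lam s @[s --> (0 : R)] --> (0 : R).
  exact: hu coord_d.
(* As the coefficient has a finite limit, the corrected curve [u'] still tends to [0]. *)
have c_cvg : - (1 + lam s)^-1 @[s --> (0 : R)] --> (-1 : R).
  have h : (1 + lam s) @[s --> (0 : R)] --> (1 + 0 : R).
    by apply: cvgD lam_cvg; exact: cvg_cst.
  rewrite (_ : -1 = - (1 + 0)^-1); last by rewrite addr0 invr1.
  by apply: cvgN; apply: cvgV h; rewrite addr0 oner_neq0.
pose c s := - (1 + lam s)^-1.
(* c s *: r s is the star-inverse of r s, so that u = r star u' while u'
   vanishes on e`_m. *)
pose u' s := star (c s *: r s) (u s).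
have u'E s x : u' s x =
    (c s * (coord e im x + coord e im (d (u s x)))) *: u s e`_m + u s x.
  by rewrite starE !scale_lfunE !rE !scalerA addrAC -scalerDl mulrDr.
have lam_near : \forall s \near (0 : R), 0 < 1 + lam s.
  near=> s; rewrite -ltrBlDl sub0r; near: s.
  by apply: (cvgr_gt _ lam_cvg); rewrite ltrN10.
have : \forall s \near (0 : R), inner_unit (u' s).
  apply: IHk => [x psi psil|].
    pose q s := coord e im (d (u s x)).
    rewrite (_ : (fun s => _) = fun s =>
      c s * (coord e im x + q s) * psi (u s e`_m) + psi (u s x));
      last by apply/funext => s; rewrite u'E psil.
    rewrite -[X in _ --> X](addr0 (0 : R)); apply: cvgD; last exact: hu psil.
    rewrite -[X in _ --> X](mulr0 (-1 * (coord e im x + 0))).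
    apply: cvgM; last exact: hu psil.
    apply: cvgM => //; apply: cvgD; [exact: cvg_cst|exact: hu coord_d].
  near=> s => i ik; rewrite u'E.
  have uk : forall i, (i + k.+1 < \dim {:g0})%N -> u s e`_i = 0 by near: s.
  (* Before column [m] both [u s] and the [m]-th coordinate vanish, so cleared columns stay clear;
     at column [m] the coefficient is [c s * (1 + lam s) = -1]. *)
  have [ilt|mi|iE] := ltngtP i m.
  - rewrite uk; last by rewrite /m in ilt; lia.
    have i_ltn : (i < \dim {:g0})%N by lia.
    rewrite lfE linear0 (coord_free (Ordinal i_ltn) im);
      last exact: basis_free (vbasisP _).
    by rewrite -val_eqE /= (ltn_eqF ilt) mulr0n !addr0 mulr0 scale0r.
  - by rewrite /m in mi; lia.
  - rewrite iE (coord_free im im) ?(basis_free (vbasisP _)) // eqxx -/(lam s).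
    have h : 0 < 1 + lam s by near: s.
    by rewrite mulNr mulVf ?gt_eqF// scaleN1r addNr.
move=> u'_inner; near=> s.
have h : 0 < 1 + lam s by near: s.
have -> : u s = star (r s) (u' s).
  rewrite starA -{1}[r s]scale1r (scale_star _ _ (hr s)).
  rewrite (_ : _ + _ + _ = 0) ?scale0r ?star0// /c.
  by field; rewrite gt_eqF.
apply: inner_unit_star; first exact: inner_unit_exp (hr s) h.
by near: s.
Unshelve. all: by end_near.
Qed.

End InnerUnits.

(** * The conditions of normality *)

Section NormalInner.
Variables (R : realType) (g0 g1 : vectType R) (g : lie2Algebra g0 g1).
Local Notation d := (ldiff g).
Implicit Types (A B : aut0 g) (v w : autm1 g).

Lemma subgroup_Inn0 : subgroup (Inn0 g).
Proof. exact: connected_lie_subgroup_subgroup. Qed.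

Lemma Innm1_boundary v : Innm1 g v -> Inn0 g (aut_bd v).
Proof.
apply: connected_lie_subgroup_morph; first exact: aut_bdM.
move=> X c _ hc; exists (ad0 g 0 + dbar g X); first by exists 0, X.
apply: boundary_velocity; last exact: hc.2.
by rewrite (one_parameter_subgroup0 hc).
Qed.

Lemma Innm1_act A v : Innm1 g v -> Innm1 g (aut_act A v).
Proof.
apply: connected_lie_subgroup_morph; first exact: aut_actMr.
move=> X c _ hc; exists (act (aut0_val A) X) => //.
exact: has_velocity_linear (act_linear _) hc.2.
Qed.

Lemma Inn0_conj A B : Inn0 g B -> Inn0 g (A * B * A^-1)%g.
Proof.
apply: (connected_lie_subgroup_morph (f := fun B => (A * B * A^-1)%g)).
  by move=> B1 B2; rewrite !mulgA mulgVK.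
move=> X c [x [t ->]] hc; eexists; last first.
  apply: (conj_velocity (aut0P A) _ hc.2).
  by rewrite (one_parameter_subgroup0 hc).
by eexists _, _.
Qed.

Definition displacement A v : autm1 g := (aut_act A v * v^-1)%g.

Lemma displacementM A B v :
  displacement (A * B)%g v =
    (aut_act A (displacement B v) * displacement A v)%g.
Proof. by rewrite /displacement mulgA -aut_actMr mulgVK -aut_actM. Qed.

(** In the cocycle identity the displacement by [B] is moved by [A], which keeps it in [Inn^{-1}] by
    [Innm1_act]. *)
Lemma Innm1_displacementM A B v :
  Innm1 g (displacement A v) -> Innm1 g (displacement B v) ->
  Innm1 g (displacement (A * B)%g v).
Proof.
have [_ mulP _] := subgroup_Innm1 g.
by move=> hA hB; rewrite displacementM; apply: mulP => //; exact: Innm1_act.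
Qed.

(** Each value [u s x] is differentiable at [0] and vanishes there, hence tends to [0], so the
    elimination applies with [k] the dimension, where its vanishing condition is empty. *)
Lemma Innm1_displacement_near (c : R -> aut0 g) X v :
  one_parameter_subgroup (@aut0_val _ _ _ g) c X ->
  \forall s \near (0 : R), Innm1 g (displacement (c s) v).
Proof.
move=> hc; pose f := autm1_val v; pose k := autm1_val (v^-1)%g.
pose u s := autm1_val (displacement (c s) v).
(* The inverse of [c s] is written [c (- s)], so that its velocity is that of a reversed curve. *)
pose a s x := c1 (aut0_val (c s)) (f (c0 (aut0_val (c (- s))) x)).
have uE s x : u s x = a s x + k x + a s (d (k x)).
  by rewrite /a (one_parameter_subgroupN _ hc) starE !actE.
have u0 : u 0 = 0.
  by rewrite /u (one_parameter_subgroup0 hc) /displacement aut_act1 mulgV.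
have a_velocity x : exists Y, has_velocity (a^~ x) Y.
  eexists; apply: has_velocity_app.
    exact: has_velocity_linear (@linear_c1 R g0 g1) hc.2.
  apply: has_velocity_homo; apply: has_velocity_eval.
  exact: has_velocity_linear (@linear_c0 R g0 g1) (has_velocity_opp hc.2).
have : \forall s \near (0 : R), inner_unit g (u s).
  apply: (@inner_unit_near_ker _ _ _ _ (\dim {:g0})) => [x psi psil|];
    last by near=> s => i; lia.
  have [Y hY] := a_velocity x; have [Z hZ] := a_velocity (d (k x)).
  have h := has_velocityD (has_velocityD hY (has_velocity_cst (k x))) hZ.
  have := has_velocity_cvg h psil; rewrite -uE.
  rewrite u0 lfE (_ : psi 0 = 0); last first.
    by have := psil (-1) 0 0; rewrite scaler0 addr0 scaleN1r addNr.
  by apply: cvg_trans; apply: near_eq_cvg; near=> s; rewrite uE.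
by apply: filterS => s; exact: inner_unit_val.
Unshelve. all: by end_near.
Qed.

Lemma Innm1_displacement B v : Inn0 g B -> Innm1 g (displacement B v).
Proof.
(* The quantifier over [v] serves inverses: the displacement of [w] by [A^-1] is the inverse of the
   displacement by [A] of the image of [w] under [A^-1]. *)
pose N := [set B | forall v, Innm1 g (displacement B v)].
suff : Inn0 g `<=` N by move=> h /h; exact.
have [one mulP invP] := subgroup_Innm1 g.
apply: connected_lie_subgroup_sub => [|X _ _ [c hc <-] {}v].
  split=> [w|A C hA hC w|A hA w].
  - by rewrite /displacement aut_act1 mulgV.
  - exact: Innm1_displacementM.
  - rewrite -[displacement _ _]invgK; apply: invP.
    rewrite (_ : (_^-1)%g = displacement A (aut_act (A^-1)%g w));
      first exact: hA.
    by rewrite /displacement invgM invgK -aut_actM mulgV aut_act1.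
have mult n s : Innm1 g (displacement (c s) v) ->
    Innm1 g (displacement (c (s *+ n)) v).
  move=> hs; elim: n => [|n IHn].
    by rewrite mulr0n (one_parameter_subgroup0 hc) /displacement aut_act1 mulgV.
  by rewrite mulrS hc.1; exact: Innm1_displacementM.
(* Some [1 / (n + 1)] lies in the neighbourhood, and [mult] leads from it to [c 1] in [n + 1]
   steps. *)
have /nbhs_ballP [eps /= eps0 heps] := Innm1_displacement_near v hc.
have [n hn] := ltr_add_invr (y := 0) eps0.
rewrite -(_ : (n.+1%:R^-1 : R) *+ n.+1 = 1); last first.
  by rewrite -[_ *+ _]mulr_natr mulVf ?pnatr_eq0.
apply: mult; apply: heps.
rewrite -ball_normE /= sub0r normrN ger0_norm ?invr_ge0//.
by rewrite add0r in hn.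
Qed.

End NormalInner.

Theorem theorem6p9 (R : realType) (g0 g1 : vectType R)
    (g : lie2Algebra g0 g1) :
  @normal_sub_crossed_module (aut g) (Innm1 g) (Inn0 g).
Proof.
split; first split.
- exact: subgroup_Innm1.
- exact: subgroup_Inn0.
- exact: Innm1_boundary.
- by move=> A v _; exact: Innm1_act.
- exact: Inn0_conj.
- exact: Innm1_act.
- exact: Innm1_displacement.
Qed.
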